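(* Let $A\in\mathbb{R}^{n\times m}$ be a nonzero matrix of rank $r$ with positive singular values $s_1\ge\dots\ge s_r>0$, let $\mathbf{g}^\dag=A\mathbf{f}^\dag$ for some $\mathbf{f}^\dag\in\mathbb{R}^m$, with $\mathbf{g}^\dag\ne0$, and put $\rho=\|\mathbf{g}^\dag\|$. Then there exists $\alpha_0>0$ (depending on $A$ and $\mathbf{g}^\dag$, but not on $\sigma$) such that for every $\sigma>0$ the following holds. Let $h=\sigma^2/\rho^2$ and let $\alpha^*$ be the minimizer over $[0,s_1^2/2]$ of $$T_h(\alpha)=\frac{\alpha^2}{(\alpha+s_1^2)^2}+h\sum_{i=1}^r\frac{s_i^4}{(\alpha+s_i^2)^2}.$$ If $\alpha^*\le\alpha_0$, then there exists a local minimizer $\hat\alpha\in(0,\infty)$ of the predictive risk $\alpha\mapsto p_\alpha(\mathbf{g}^\eta)$ with $\hat\alpha\le\alpha^*$.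
   Context: $\|\cdot\|$ is the Euclidean norm and $A^*$ the transpose of $A$. The noisy data are $\mathbf{g}^\eta=\mathbf{g}^\dag+\boldsymbol{\eta}$, where $\boldsymbol{\eta}$ is a Gaussian random vector in $\mathbb{R}^n$ with mean zero and covariance $\sigma^2I$. For $\alpha>0$ the Tikhonov influence matrix is $X_\alpha=A(A^*A+\alpha I)^{-1}A^*\in\mathbb{R}^{n\times n}$, and the predictive risk is $$p_\alpha(\mathbf{g}^\eta)=\mathbb{E}_{\boldsymbol{\eta}}\bigl[\|X_\alpha\mathbf{g}^\eta-\mathbf{g}^\dag\|^2\bigr]=\|(X_\alpha-I)\mathbf{g}^\dag\|^2+\sigma^2\|X_\alpha\|_F^2,$$ with $\|\cdot\|_F$ the Frobenius norm. The minimizer of $T_h$ over $[0,s_1^2/2]$ is unique, since $T_h$ is strictly convex there. *)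

(* Defs.v *)
From HB Require Import structures.
From mathcomp Require Import all_boot all_order all_algebra.
From mathcomp Require Import all_classical all_reals all_analysis.

Set Implicit Arguments.
Unset Strict Implicit.
Unset Printing Implicit Defensive.

Import Order.TTheory GRing.Theory Num.Theory.
Import numFieldNormedType.Exports.

Local Open Scope classical_set_scope.
Local Open Scope ring_scope.

(* The library norm `|v| on matrices is the sup norm, not the Euclidean one. *)
Definition euclid_norm (R : realType) (n : nat) (v : 'cV[R]_n) : R :=
  Num.sqrt (\sum_(i < n) v i 0 ^+ 2).

(* [s] lists, in nonincreasing order, the square roots of the nonzero
   eigenvalues of A^T A, with algebraic multiplicity. *)
Definition positive_singular_values (R : realType) (n m : nat)
    (A : 'M[R]_(n, m)) (s : seq R) : Prop :=
  [/\ sorted >=%R s,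
      {in s, forall x, 0 < x} &
      char_poly (A^T *m A) =
        'X^(m - size s) * \prod_(x <- s) ('X - (x ^+ 2)%:P)].

(* [normal_prob m 0] is not a point mass in the library (it is uniform on
   [0, 1]), so degenerate normal laws are treated separately. *)
Definition gaussian_law (R : realType) (m sd : R) (B : set R) : \bar R :=
  if sd == 0 then \d_m B else normal_prob m sd B.

Definition gaussian_vector (d : measure_display) (T : measurableType d)
    (R : realType) (P : probability T R) (n : nat) (X : T -> 'cV[R]_n) : Prop :=
  (forall i : 'I_n, measurable_fun [set: T] (fun w => X w i 0)) /\
  forall u : 'cV[R]_n, exists m sd : R, forall B : set R, measurable B ->
    P ((fun w => \sum_(i < n) u i 0 * X w i 0) @^-1` B) = gaussian_law m sd B.

Definition has_mean (d : measure_display) (T : measurableType d)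
    (R : realType) (P : probability T R) (n : nat) (X : T -> 'cV[R]_n)
    (mu : 'cV[R]_n) : Prop :=
  forall i : 'I_n, 'E_P[(fun w => X w i 0)%R]%E = (mu i 0)%:E.

Definition has_covariance (d : measure_display) (T : measurableType d)
    (R : realType) (P : probability T R) (n : nat) (X : T -> 'cV[R]_n)
    (C : 'M[R]_n) : Prop :=
  forall i j : 'I_n,
    covariance P (fun w => X w i 0) (fun w => X w j 0) = (C i j)%:E.

Definition influence (R : realType) (n m : nat) (A : 'M[R]_(n, m)) (a : R) :
    'M[R]_n :=
  A *m invmx (A^T *m A + a%:M) *m A^T.

Definition predictive_risk (d : measure_display) (T : measurableType d)
    (R : realType) (P : probability T R) (n m : nat) (A : 'M[R]_(n, m))
    (g : 'cV[R]_n) (eta : T -> 'cV[R]_n) (a : R) : \bar R :=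
  'E_P[(fun w => euclid_norm (influence A a *m (g + eta w) - g) ^+ 2)%R]%E.

(* [s`_0] is the largest singular value s_1. *)
Definition T_fun (R : realType) (s : seq R) (h a : R) : R :=
  a ^+ 2 / (a + s`_0 ^+ 2) ^+ 2 +
  h * \sum_(x <- s) x ^+ 4 / (a + x ^+ 2) ^+ 2.

Definition is_minimizer_on (R : realType) (D : set R) (f : R -> R) (x : R) :
    Prop :=
  D x /\ forall y, D y -> f x <= f y.

Definition is_local_minimizer_on (R : realType) (D : set R) (f : R -> \bar R)
    (x : R) : Prop :=
  D x /\ \forall y \near x, D y -> (f x <= f y)%E.

(* Main.v *)
(* In the singular basis p_a = rho^2 q(a), where
     q(a) = sum_i w_i a^2 / (a + l_i)^2 + h sum_i s_i^4 / (a + s_i^2)^2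
   with weights w_i >= 0 of sum 1 and every l_i a squared singular value, while
   T_h is the same function with all the weight put on l = s_1^2.  Since the
   increments of a^2 / (a + t)^2 decrease in t for t >= a, the difference
   q - T_h is nondecreasing on [0, s_r^2].  Take a minimizer b of q over
   [0, alpha*].  It is not 0, because the variance term decreases to first order
   there whereas the bias term is quadratic.  If b < alpha* then b is an
   interior minimizer; if b = alpha*, then to the right of alpha* both T_h and
   q - T_h are at least their values at alpha*, so b is again a local minimizer. *)
Require Import Defs.
From HB Require Import structures.
From mathcomp Require Import all_boot all_order all_algebra.
From mathcomp Require Import all_classical all_reals all_analysis.
From mathcomp Require Import ring lra.

Import Order.TTheory GRing.Theory Num.Theory.
Import numFieldNormedType.Exports.

Local Open Scope classical_set_scope.
Local Open Scope ring_scope.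

(** * Second moments of affine images of the noise *)

Lemma expectation_lincomb (d : measure_display) (T : measurableType d)
    (R : realType) (P : probability T R) (I : Type) (s : seq I)
    (F : I -> T -> R) (c e : I -> R) :
  (forall i, F i \in Lfun P 1) -> (forall i, 'E_P[F i] = (e i)%:E)%E ->
  (fun w => \sum_(i <- s) c i * F i w) \in Lfun P 1 /\
  ('E_P[fun w => (\sum_(i <- s) c i * F i w)%R] =
     (\sum_(i <- s) c i * e i)%R%:E)%E.
Proof.
move=> LF EF; elim: s => [|i s [IHL IHE]].
  under eq_fun do rewrite big_nil.
  by rewrite big_nil; split; [exact: Lfun_cst|exact: expectation_cst].
have -> : (fun w => \sum_(j <- i :: s) c j * F j w) =
    (c i \o* F i) \+ (fun w => \sum_(j <- s) c j * F j w).
  by apply/funext => w; rewrite big_cons /= mulrC.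
have LiF : c i \o* F i \in Lfun P 1 by exact: Lfun_scale.
split; first exact: rpredD.
by rewrite expectationD // expectationZl // EF IHE big_cons EFinD EFinM.
Qed.

Section risk.
Context (d : measure_display) (T : measurableType d) (R : realType).
Variables (P : probability T R) (n : nat) (X : T -> 'cV[R]_n) (sigma : R).
Hypothesis mX : forall i, measurable_fun [set: T] (fun w => X w i 0).
Hypothesis X_mean : has_mean P X 0.
Hypothesis X_cov : has_covariance P X (sigma ^+ 2)%:M.

Lemma expectation_coordM i j :
  ('E_P[((fun w => X w i 0) \* (fun w => X w j 0))%R] = ((sigma ^+ 2)%:M i j)%R%:E)%E.
Proof.
rewrite -X_cov covariance.unlock !X_mean !mxE; congr ('E_P[_])%E; apply/funext => w.
by rewrite !fctE /= !subr0.
Qed.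

(* A finite variance is what makes the coordinates integrable: an expectation
   equal to 0 is no evidence of integrability. *)
Lemma coord_Lfun2 i : (fun w => X w i 0) \in Lfun P 2%:E.
Proof.
rewrite inE/=; apply/andP; split; rewrite inE//=.
rewrite /finite_norm; apply: (@lty_poweRy _ _ 2) => //.
rewrite poweR_Lnorm // (_ : (\int[P]_x _)%E = (sigma ^+ 2)%:E) ?ltry //.
have := expectation_coordM i i; rewrite mxE eqxx mulr1n expectation.unlock => <-.
apply: eq_integral => w _ /=.
by rewrite powR_mulrn // real_normK ?num_real // expr2.
Qed.

Lemma coord_Lfun1 i : (fun w => X w i 0) \in Lfun P 1.
Proof. exact: Lfun_subset12 (fin_num_measure _ _ measurableT) _ (coord_Lfun2 i). Qed.

(** Expanding the square leaves the covariances, a linear term that vanishes because the mean is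
    zero, and a constant. *)
Lemma expectation_sqr_affine (b : R) (c : 'I_n -> R) :
  let Y w := (\sum_j c j * X w j 0 + b) ^+ 2 in
  Y \in Lfun P 1 /\
  ('E_P[Y] = (sigma ^+ 2 * (\sum_j c j ^+ 2) + b ^+ 2)%R%:E)%E.
Proof.
move=> Y.
(* Indexing products by pairs turns the squared sum into one finite linear combination. *)
pose F (p : 'I_n * 'I_n) := (fun w => X w p.1 0) \* (fun w => X w p.2 0).
have LF p : F p \in Lfun P 1 by apply: Lfun2_mul_Lfun1; exact: coord_Lfun2.
have [L1 E1] := @expectation_lincomb _ _ _ P _ (index_enum _) F
  (fun p => c p.1 * c p.2) (fun p => (sigma ^+ 2)%:M p.1 p.2) LF
  (fun p => expectation_coordM p.1 p.2).
have [L2 E2] := @expectation_lincomb _ _ _ P _ (index_enum _) (fun i w => X w i 0)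
  (fun j => 2 * b * c j) (fun=> 0) coord_Lfun1
  (fun i => etrans (X_mean i) (congr1 EFin (mxE _ _ _ _))).
have L3 : cst (b ^+ 2) \in Lfun P 1 by exact: Lfun_cst.
have -> : Y = (fun w => \sum_p c p.1 * c p.2 * F p w) \+
   (fun w => \sum_j 2 * b * c j * X w j 0) \+ cst (b ^+ 2).
  apply/funext => w; rewrite /Y /= sqrrD; congr (_ + _ + _).
    rewrite expr2 big_distrl /=.
    under eq_bigr do rewrite big_distrr/=.
    rewrite pair_bigA /=; apply: eq_bigr => -[i j] _ /=.
    by rewrite /F /= mulrACA.
  by rewrite -mulr_natl mulr_suml mulr_sumr; apply: eq_bigr => j _; ring.
have L12 := rpredD L1 L2.
split; first exact: rpredD.
rewrite (expectationD (L12 (lexx _)) L3) (expectationD L1 L2) E1 E2 expectation_cst -!EFinD; congr (_%:E).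
rewrite [X in _ + X + _]big1 ?addr0; last by move=> j _; rewrite mulr0.
congr (_ + _); rewrite big_distrr/=.
rewrite -(pair_bigA _ (fun i j => c i * c j * (sigma ^+ 2)%:M i j)) /=.
apply: eq_bigr => i _; rewrite (bigD1 i) //= mxE eqxx mulr1n big1 ?addr0.
  by rewrite mulrC expr2.
by move=> j ij; rewrite mxE eq_sym (negbTE ij) mulr0.
Qed.

(** Bias-variance decomposition: with [B] the influence matrix and [b] the bias, the noise
    contributes [sigma ^+ 2] times the squared Frobenius norm of [B]. *)
Lemma expectation_sqnorm_affine k (B : 'M[R]_(k, n)) (b : 'cV[R]_k) :
  ('E_P[fun w => (euclid_norm (B *m X w + b) ^+ 2)%R] =
     (sigma ^+ 2 * (\sum_i \sum_j B i j ^+ 2) + euclid_norm b ^+ 2)%R%:E)%E.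
Proof.
pose F i w := (\sum_j B i j * X w j 0 + b i 0) ^+ 2.
have H i := expectation_sqr_affine (b i 0) (B i).
have [_] := @expectation_lincomb _ _ _ P _ (index_enum _) F (fun=> 1) _
   (fun i => (H i).1) (fun i => (H i).2).
rewrite /F => E; rewrite (_ : (fun w => _) = (fun w => \sum_i 1 * F i w)); last first.
  apply/funext => w; rewrite /euclid_norm sqr_sqrtr ?sumr_ge0 // => [|i _]; last exact: sqr_ge0.
  by apply: eq_bigr => i _; rewrite !mxE mul1r.
rewrite E; congr (_%:E).
under eq_bigr do rewrite mul1r.
rewrite big_split /= big_distrr /=; congr (_ + _).
by rewrite /euclid_norm sqr_sqrtr // sumr_ge0 // => i _; exact: sqr_ge0.
Qed.
End risk.

(** * Orthogonal diagonalization of symmetric matrices *)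

Lemma char_poly_conj (R : comUnitRingType) n (Q M : 'M[R]_n) :
  Q *m Q^T = 1%:M -> char_poly (Q *m M *m Q^T) = char_poly M.
Proof.
move=> QQ; rewrite /char_poly.
have PQ : map_mx polyC Q *m map_mx polyC Q^T = 1%:M by rewrite -map_mxM QQ map_mx1.
have -> : char_poly_mx (Q *m M *m Q^T) =
    map_mx polyC Q *m char_poly_mx M *m map_mx polyC Q^T.
  rewrite /char_poly_mx mulmxBr mulmxBl !map_mxM mul_mx_scalar -scalemxAl PQ.
  by rewrite scalemx1.
by rewrite !det_mulmx mulrAC -det_mulmx PQ det1 mul1r.
Qed.

Lemma mulmx_tr_row (R : pzRingType) n (u : 'rV[R]_n) :
  (u *m u^T) 0 0 = \sum_i u 0 i ^+ 2.
Proof. by rewrite mxE; apply: eq_bigr => i _; rewrite mxE. Qed.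

Lemma mulmx_tr_row_gt0 (R : realDomainType) n (u : 'rV[R]_n) :
  u != 0 -> 0 < (u *m u^T) 0 0.
Proof.
move=> u0; have ge0 i : true -> 0 <= u 0 i ^+ 2 by rewrite sqr_ge0.
rewrite mulmx_tr_row lt_neqAle sumr_ge0 // andbT eq_sym.
apply: contra u0; rewrite psumr_eq0 // => /allP H; apply/eqP/rowP => i.
by have := H i (mem_index_enum _); rewrite !mxE sqrf_eq0 => /eqP.
Qed.

(** [Q] is symmetric, and its square is the identity because [u *m u^T = k%:M] makes the quadratic
    term cancel the two cross terms. *)
Lemma reflection_orthogonal (F : fieldType) n (u : 'rV[F]_n) (k : F) :
  u *m u^T = k%:M -> k != 0 ->
  let Q := 1%:M - (2 / k) *: (u^T *m u) in Q *m Q^T = 1%:M.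
Proof.
move=> uu k0 Q; have -> : Q^T = Q.
  by rewrite /Q linearB /= trmx1 linearZ /= trmx_mul trmxK.
rewrite /Q mulmxBl mul1mx mulmxBr mulmx1 -scalemxAr -scalemxAl mulmxA.
rewrite -[u^T *m u *m u^T]mulmxA uu mul_mx_scalar -!scalemxAl !scalerA.
by apply/matrixP => i j; rewrite !mxE; field.
Qed.

(* Householder reflection exchanging [v] and the first basis vector. *)
Lemma unit_row_orthogonal (R : realFieldType) n (v : 'rV[R]_(1 + n)) :
  v *m v^T = 1%:M ->
  exists Q : 'M[R]_(1 + n), Q *m Q^T = 1%:M /\ delta_mx 0 0 *m Q = v.
Proof.
move=> v1; set e : 'rV[R]_(1 + n) := delta_mx 0 0.
have [<-|neq] := eqVneq e v.
  by exists 1%:M; rewrite trmx1 !mulmx1.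
pose u := v - e.
pose k := (u *m u^T) 0 0.
have uu : u *m u^T = k%:M by rewrite -mx11_scalar.
have k0 : k != 0.
  by rewrite gt_eqF // mulmx_tr_row_gt0 // subr_eq0 eq_sym.
have ee : e *m e^T = 1%:M.
  by rewrite /e trmx_delta mul_delta_mx; apply/matrixP => i j; rewrite !ord1 !mxE.
(* Since [v] and [e] are unit rows, |v - e|^2 = 2 - 2 e.v = -2 e.u; hence the reflection along [u]
   sends [e] to [e + u = v]. *)
have keu : k%:M = - 2 *: (e *m u^T).
  rewrite -uu /u linearB /= !mulmxBl !mulmxBr v1 ee.
  have -> : v *m e^T = e *m v^T.
    by rewrite -[v in LHS]trmxK -trmx_mul [LHS]mx11_scalar mxE -mx11_scalar.
  by apply/matrixP => i j; rewrite !mxE; lra.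
pose c := 2 / k.
exists (1%:M - c *: (u^T *m u)); split.
  exact: reflection_orthogonal _ _ _ _ uu k0.
rewrite mulmxBr mulmx1 -scalemxAr mulmxA.
have -> : e *m u^T = (- k / 2)%:M.
  by apply/matrixP => i j; have /matrixP/(_ i j) := keu; rewrite !mxE !ord1 eqxx /= !mulr1n => ->; field.
rewrite mul_scalar_mx scalerA /c.
have -> : 2 / k * (- k / 2) = -1 by field.
by rewrite scaleN1r opprK /u addrC subrK.
Qed.

(* The splitting of the characteristic polynomial supplies real eigenvalues,
   so no passage to the complex numbers is needed. *)
Theorem symmetric_diagonalization (R : rcfType) n (M : 'M[R]_n) (l : seq R) :
  M^T = M -> char_poly M = \prod_(x <- l) ('X - x%:P) ->
  exists P : 'M[R]_n, P *m P^T = 1%:M /\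
    M = P^T *m diag_mx (\row_i l`_i) *m P.
Proof.
elim: n M l => [|n IH] M l MT Ml.
  by exists 1%:M; split; apply/matrixP => -[].
have : size l = n.+1.
  by have := size_char_poly M; rewrite Ml size_prod_XsubC => -[].
case: l Ml => [//|x l] Ml _.
have : eigenvalue M x.
  by rewrite eigenvalue_root_char Ml big_cons rootM root_XsubC eqxx.
move=> /eigenvalueP [v0 v0M v00].
pose N := (v0 *m v0^T) 0 0.
have N0 : 0 < N by exact: mulmx_tr_row_gt0.
pose v : 'rV[R]_(1 + n) := (Num.sqrt N)^-1 *: v0.
have v1 : v *m v^T = 1%:M.
  rewrite /v linearZ /= -scalemxAl -scalemxAr scalerA -invfM -expr2 sqr_sqrtr ?ltW //.
  by rewrite [v0 *m _]mx11_scalar scale_scalar_mx mulVf ?gt_eqF.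
have vM : v *m M = x *: v by rewrite /v -scalemxAl v0M !scalerA mulrC.
have [Q [QQ Qv]] := unit_row_orthogonal _ _ _ v1.
have QtQ := mulmx1C QQ.
pose M1 : 'M[R]_(1 + n) := Q *m M *m Q^T.
have M1T : M1^T = M1 by rewrite /M1 !trmx_mul trmxK MT mulmxA.
(* The first basis row is an eigenvector of [M1], which fixes the first row of [M1]; symmetry then
   fixes the first column, so [M1] is block diagonal. *)
have eM1 : delta_mx 0 0 *m M1 = x *: (delta_mx 0 0 : 'rV[R]_(1 + n)).
  by rewrite /M1 !mulmxA Qv vM -scalemxAl -Qv -mulmxA QQ mulmx1.
have M1def : M1 = Q *m M *m Q^T by [].
clearbody M1.
have M1row j : M1 0 j = x *+ (j == 0).
  by have /rowP/(_ j) := eM1; rewrite -rowE !mxE eqxx mulr_natr.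
have M1E : M1 = block_mx x%:M 0 0 (drsubmx M1).
  rewrite -[LHS]submxK; congr block_mx; apply/matrixP => i j; rewrite !ord1 !mxE.
  - by rewrite !lshift0 M1row.
  - by rewrite lshift0 M1row.
  - by rewrite lshift0 -M1T mxE M1row.
have [||P [PP DP]] := IH (drsubmx M1) l.
- by rewrite trmx_drsub M1T.
- have : char_poly_mx (block_mx x%:M 0 0 (drsubmx M1)) =
      block_mx ('X - x%:P)%:M 0 0 (char_poly_mx (drsubmx M1)) :> 'M[_]_(1 + n).
    rewrite /char_poly_mx map_block_mx !map_mx0 map_scalar_mx scalar_mx_block.
    by rewrite opp_block_mx add_block_mx !oppr0 !addr0 raddfB.
  rewrite -M1E => E.
  (* Cancelling the factor of [x] leaves a lower block whose characteristic polynomial splits over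
     [l], as the induction hypothesis demands. *)
  have cM1 : char_poly M1 = ('X - x%:P) * char_poly (drsubmx M1).
    by rewrite /char_poly E (det_ublock ('X - x%:P)%:M) det_scalar1.
  have := char_poly_conj _ _ _ M QQ; rewrite -M1def Ml cM1 big_cons => /mulfI -> //.
  by rewrite polyXsubC_eq0.
pose P1 : 'M[R]_(1 + n) := block_mx 1%:M 0 0 P.
have P1T : P1^T = block_mx 1%:M 0 0 P^T by rewrite tr_block_mx trmx1 !trmx0.
have P1P : P1 *m P1^T = 1%:M.
  rewrite P1T /P1 mulmx_block !mulmx0 !mul0mx !mulmx1 !addr0 add0r PP.
  by rewrite -scalar_mx_block.
exists (P1 *m Q); split; first by rewrite trmx_mul mulmxA -[P1 *m Q *m _]mulmxA QQ mulmx1.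
have -> : M = Q^T *m M1 *m Q by rewrite M1def !mulmxA QtQ mul1mx -mulmxA QtQ mulmx1.
rewrite trmx_mul.
have DE : diag_mx (\row_i (x :: l)`_i) =
   block_mx x%:M 0 0 (diag_mx (\row_i l`_i)) :> 'M[R]_(1 + n).
  rewrite -[LHS]submxK; congr block_mx; apply/matrixP => i j;
    rewrite ?ord1 !mxE //= ?(mul0rn, mulr0n) //.
have -> : M1 = P1^T *m block_mx x%:M 0 0 (diag_mx (\row_i l`_i)) *m P1.
  rewrite P1T M1E {1}DP /P1 !mulmx_block.
  by rewrite !mulmx0 !mul0mx !mulmx1 !mul1mx !addr0 !add0r !mul0mx.
by rewrite !mulmxA; congr (_ *m _ *m _ *m _ *m _); exact: esym DE.
Qed.

(** * The influence matrix in the singular basis *)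

Lemma sqr_euclid_norm (R : realType) k (v : 'cV[R]_k) : euclid_norm v ^+ 2 = (v^T *m v) 0 0.
Proof.
rewrite /euclid_norm sqr_sqrtr ?sumr_ge0 // => [|i _]; last exact: sqr_ge0.
by rewrite mxE; apply: eq_bigr => i _; rewrite mxE expr2.
Qed.

Lemma sqr_euclid_norm_gt0 (R : realType) k (v : 'cV[R]_k) :
  v != 0 -> 0 < euclid_norm v ^+ 2.
Proof.
move=> v0; rewrite sqr_euclid_norm -{2}[v]trmxK mulmx_tr_row_gt0 //.
by apply: contra v0 => /eqP v0; rewrite -[v]trmxK v0 trmx0.
Qed.

Section spectral_risk.
Context (R : realType) (n m : nat) (A : 'M[R]_(n, m)) (P : 'M[R]_m).
Variable (l : 'rV[R]_m).
Hypothesis PP : P *m P^T = 1%:M.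
Hypothesis AA : A^T *m A = P^T *m diag_mx l *m P.

(** Functional calculus of [A^T *m A]: the rows of [P] are its eigenvectors, and [phi e] replaces
    the eigenvalues by [e]. *)
Let phi (e : 'rV[R]_m) := P^T *m diag_mx e *m P.

Let phiM (e e' : 'rV[R]_m) : phi e *m phi e' = phi (\row_i (e 0 i * e' 0 i)).
Proof.
rewrite /phi !mulmxA -[_ *m P *m P^T]mulmxA PP mulmx1 -[_ *m diag_mx e *m _]mulmxA.
congr (_ *m _ *m _); apply/matrixP => i j; rewrite mul_diag_mx !mxE.
by case: eqP => [->|]; rewrite ?mulr1n ?mulr0n ?mulr0.
Qed.

Let phi_const (a : R) : phi (const_mx a) = a%:M.
Proof. by rewrite /phi diag_const_mx mul_mx_scalar -scalemxAl (mulmx1C PP) scalemx1. Qed.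

Let phiT (e : 'rV[R]_m) : (phi e)^T = phi e.
Proof. by rewrite /phi !trmx_mul trmxK tr_diag_mx mulmxA. Qed.

Let tr_phi (e : 'rV[R]_m) : \tr (phi e) = \sum_i e 0 i.
Proof. by rewrite /phi mxtrace_mulC mulmxA PP mul1mx mxtrace_diag. Qed.

Let quad_phi (e : 'rV[R]_m) (v : 'cV[R]_m) :
  (v^T *m phi e *m v) 0 0 = \sum_i e 0 i * (P *m v) i 0 ^+ 2.
Proof.
rewrite /phi !mulmxA -trmx_mul -mulmxA mxE; apply: eq_bigr => i _.
by rewrite mul_mx_diag mxE [(_)^T _ _]mxE expr2 mulrAC mulrC.
Qed.

Lemma sqr_norm_image (f : 'cV[R]_m) :
  euclid_norm (A *m f) ^+ 2 = \sum_i l 0 i * (P *m f) i 0 ^+ 2.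
Proof. by rewrite sqr_euclid_norm trmx_mul mulmxA -(mulmxA f^T) AA quad_phi. Qed.

Variable a : R.
Hypothesis la : forall i, l 0 i + a != 0.

Let N := phi (\row_i (l 0 i + a)^-1).

Let resolvent : invmx (A^T *m A + a%:M) = N /\ N *m (A^T *m A + a%:M) = 1%:M.
Proof.
have MN : A^T *m A + a%:M = phi (\row_i (l 0 i + a)).
  rewrite AA -phi_const /phi -mulmxDl -mulmxDr -raddfD; congr (_ *m diag_mx _ *m _).
  by apply/rowP => i; rewrite !mxE.
have NM : N *m (A^T *m A + a%:M) = 1%:M.
  rewrite MN phiM -phi_const; congr phi; apply/rowP => i.
  by rewrite !mxE mulVf.
split=> //; have [_ MU] := mulmx1_unit NM.
by rewrite -[RHS]mulmx1 -(mulmxV MU) mulmxA NM mul1mx.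
Qed.

(** Cyclicity of the trace rewrites the squared Frobenius norm as the trace of the square of
    [A^T *m A *m N], which is a function of [A^T *m A] alone. *)
Lemma influence_frobenius :
  \sum_i \sum_j influence A a i j ^+ 2 = \sum_i (l 0 i / (l 0 i + a)) ^+ 2.
Proof.
have [XN _] := resolvent; rewrite /influence XN.
pose X := A *m N *m A^T.
have -> : \sum_i \sum_j (A *m N *m A^T) i j ^+ 2 = \tr (X *m X^T).
  rewrite /mxtrace; apply: eq_bigr => i _; rewrite mxE.
  by apply: eq_bigr => j _; rewrite [X in _ * X]mxE expr2 mxE.
rewrite (_ : X^T = A *m (N *m A^T)); last by rewrite /X trmx_mul trmxK trmx_mul phiT.
rewrite /X !mulmxA mxtrace_mulC !mulmxA -(mulmxA _ A^T A) AA.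
rewrite [X in \tr X](_ : _ = phi l *m N *m phi l *m N); last by rewrite /phi !mulmxA.
rewrite !phiM tr_phi; apply: eq_bigr => i _; rewrite !mxE expr2.
by rewrite !mulrA.
Qed.

(** The identity [N *m (A^T *m A) = 1%:M - a *: N] turns the bias vector into
    [A *m (- a *: N *m f)], whose norm is read off in the eigenbasis. *)
Lemma influence_bias (f : 'cV[R]_m) :
  euclid_norm (influence A a *m (A *m f) - A *m f) ^+ 2 =
  \sum_i l 0 i * (P *m f) i 0 ^+ 2 * (a ^+ 2 / (a + l 0 i) ^+ 2).
Proof.
have [XN NM] := resolvent; rewrite /influence XN.
have -> : A *m N *m A^T *m (A *m f) - A *m f = A *m (- a *: N *m f).
  rewrite -!mulmxA -mulmxBr; congr (A *m _).
  have NAA : N *m (A^T *m A) = 1%:M - a *: N.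
    by rewrite -NM mulmxDr mul_mx_scalar addrK.
  by rewrite !mulmxA -(mulmxA N) NAA mulmxBl mul1mx addrC addKr scaleNr mulNmx.
rewrite sqr_norm_image; apply: eq_bigr => i _.
have -> : (P *m (- a *: N *m f)) i 0 = - a * ((l 0 i + a)^-1 * (P *m f) i 0).
  rewrite -scalemxAl -scalemxAr /N /phi !mulmxA PP mul1mx -mulmxA mxE.
  by congr (_ * _); rewrite mul_diag_mx !mxE.
by field; rewrite addrC la.
Qed.
End spectral_risk.

(** * Filtered risks and their local minimizers *)

(* The increment factors as
   (y - x) * (u / ((y + u) (x + u))) * (y / (y + u) + x / (x + u)),
   whose second factor decreases in u only as long as u^2 >= x y. *)
Lemma filter_increment_antitone (R : realFieldType) (x y t S : R) :
  0 <= x -> x <= y -> y <= t -> t <= S -> 0 < t ->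
  y ^+ 2 / (y + S) ^+ 2 - x ^+ 2 / (x + S) ^+ 2 <=
  y ^+ 2 / (y + t) ^+ 2 - x ^+ 2 / (x + t) ^+ 2.
Proof.
move=> x0 xy yt tS t0.
have y0 : 0 <= y by lra.
have factor u : 0 < u -> y ^+ 2 / (y + u) ^+ 2 - x ^+ 2 / (x + u) ^+ 2 =
    (y - x) * (u / ((y + u) * (x + u))) * (y / (y + u) + x / (x + u)).
  by move=> u0; field; rewrite !lt0r_neq0 //; lra.
have S0 : 0 < S by lra.
have mono u : 0 <= u -> u / (u + S) <= u / (u + t).
  by move=> u0; rewrite ler_wpM2l // lef_pV2 ?posrE //; lra.
rewrite !factor //; apply: ler_pM.
- by rewrite mulr_ge0 ?divr_ge0 ?mulr_ge0 //; lra.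
- by rewrite addr_ge0 ?divr_ge0 //; lra.
- rewrite ler_wpM2l ?subr_ge0 // ler_pdivrMr; last by rewrite mulr_gt0 //; lra.
  rewrite mulrAC ler_pdivlMr; last by rewrite mulr_gt0 //; lra.
  (* Both factors are nonnegative: [x] and [y] are at most [t], and [t <= S]. *)
  rewrite -subr_ge0 (_ : _ - _ = (S - t) * (t * S - x * y)); last by ring.
  rewrite mulr_ge0 // subr_ge0 // ler_pM //; lra.
- exact: lerD (mono _ y0) (mono _ x0).
Qed.

(** Covers both functions to be compared: the predictive risk divided by rho^2, and T_h as the case
    of a single index of weight 1. *)
Definition filtered_risk (R : realType) (I : finType) (w l : I -> R) (s : seq R)
    (h a : R) : R :=
  \sum_i w i * (a ^+ 2 / (a + l i) ^+ 2) +
  h * \sum_(x <- s) x ^+ 4 / (a + x ^+ 2) ^+ 2.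

Lemma T_fun_filtered (R : realType) (s : seq R) (h a : R) :
  T_fun s h a =
    filtered_risk R 'I_1 (fun=> 1) (fun=> s`_0 ^+ 2) s h a.
Proof. by rewrite /filtered_risk big_ord1 mul1r. Qed.

Section filtered_risk.
Context (R : realType) (I : finType) (w l : I -> R) (s : seq R) (h t0 : R).
Hypothesis w0 : forall i, 0 <= w i.
Hypothesis w1 : \sum_i w i = 1.
Hypothesis t0_gt0 : 0 < t0.
Hypothesis lt0 : forall i, t0 <= l i.
Hypothesis s_gt0 : {in s, forall x, 0 < x}.
Hypothesis h0 : 0 < h.

Local Notation q := (filtered_risk R I w l s h).

Lemma filtered_risk_continuous (a : R) : 0 <= a -> {for a, continuous q}.
Proof.
move=> a0.
have inv t : 0 < t -> (a' + t) ^- 2 @[a' --> a] --> (a + t) ^- 2.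
  move=> t_gt0; apply: cvgV.
    by rewrite expf_neq0 // lt0r_neq0 // ltr_wpDl.
  apply: (@cvg_comp _ _ _ (fun x => x + t) (fun x => x ^+ 2) _ (nbhs (a + t))).
    by apply: cvgD; [exact: cvg_id|exact: cvg_cst].
  exact: exprn_continuous.
apply: cvgD.
  apply: cvg_big => [|i _]; first exact: add_continuous.
  apply: cvgM; first exact: cvg_cst.
  apply: cvgM; first exact: exprn_continuous.
  by apply: inv; exact: lt_le_trans t0_gt0 (lt0 i).
apply: cvgM; first exact: cvg_cst.
rewrite big_seq; under eq_cvg do rewrite big_seq.
apply: cvg_big => [|x xs]; first exact: add_continuous.
apply: cvgM; first exact: cvg_cst.
by apply: inv; rewrite exprn_gt0 // s_gt0.
Qed.

(** Rules out 0 as a minimizer over [[0, c]]; it serves for T_h as well as for the normalized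
    risk. *)
Lemma filtered_risk_decr (c : R) : s != [::] -> 0 < c ->
  exists e, [/\ 0 < e, e <= c & q e < q 0].
Proof.
move=> snil c0.
have [x [s' sE]] : exists x s', s = x :: s' by case: (s) snil => // x s' _; exists x, s'.
have x0 : 0 < x by apply: s_gt0; rewrite sE mem_head.
pose S := x ^+ 2; have S0 : 0 < S by rewrite exprn_gt0.
(* The bound [e <= S] yields the linear estimate of the first variance term below; the last bound
   keeps the bias, at most [e ^+ 2 / t0 ^+ 2], within half of the gain [h * (e / (2 * S))]. *)
pose e := Num.min c (Num.min S (h * t0 ^+ 2 / (4 * S))).
have e0 : 0 < e.
  by rewrite !lt_min c0 S0 /= divr_gt0 ?mulr_gt0 ?exprn_gt0.
have eS : e <= S by rewrite /e !ge_min lexx !orbT.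
have eh : e <= h * t0 ^+ 2 / (4 * S) by rewrite /e !ge_min lexx !orbT.
have ec : e <= c by rewrite /e !ge_min lexx.
clearbody e; exists e; split=> //.
have bias : \sum_i w i * (e ^+ 2 / (e + l i) ^+ 2) <= e ^+ 2 / t0 ^+ 2.
  rewrite -[leRHS]mul1r -w1 mulr_suml; apply: ler_sum => i _.
  have li : 0 < l i by exact: lt_le_trans (lt0 i).
  rewrite ler_wpM2l // ler_wpM2l ?sqr_ge0 // lef_pV2 ?posrE ?exprn_gt0 ?addr_gt0 //.
  have le : t0 <= e + l i by apply: le_trans (lt0 i) _; rewrite lerDr ltW.
  by apply: lerXn2r; rewrite ?nnegrE ?addr_ge0 // ltW.
have bias0 : \sum_i w i * (0 ^+ 2 / (0 + l i) ^+ 2) = 0 :> R.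
  by rewrite big1 // => i _; rewrite expr0n /= mul0r mulr0.
have var (u : R) : 0 < u -> u ^+ 4 / (0 + u ^+ 2) ^+ 2 = 1.
  by move=> u0; rewrite add0r -exprM divff // expf_neq0 // gt_eqF.
rewrite /filtered_risk bias0 add0r sE !big_cons var //.
have rest : \sum_(j <- s') j ^+ 4 / (e + j ^+ 2) ^+ 2 <=
            \sum_(j <- s') j ^+ 4 / (0 + j ^+ 2) ^+ 2.
  rewrite !big_seq; apply: ler_sum => j js.
  have j1 : 0 < j by rewrite s_gt0 // sE in_cons js orbT.
  have j0 : 0 < j ^+ 2 by rewrite exprn_gt0.
  rewrite add0r ler_wpM2l ?exprn_even_ge0 // lef_pV2 ?posrE ?exprn_gt0 ?addr_gt0 //.
  by apply: lerXn2r; rewrite ?nnegrE ?addr_ge0 ?lerDr // ltW.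
have head : x ^+ 4 / (e + x ^+ 2) ^+ 2 <= 1 - e / (2 * S).
  have key : (1 - e / (2 * S)) * (e + S) ^+ 2 - S ^+ 2 =
      e * (3 * S ^+ 2 - e ^+ 2) / (2 * S) by field; rewrite lt0r_neq0.
  rewrite (exprM x 2 2) -/S ler_pdivrMr ?exprn_gt0 ?addr_gt0 // -subr_ge0 key.
  rewrite divr_ge0 ?mulr_ge0 ?subr_ge0 //; try lra.
  by rewrite -[leLHS]mul1r ler_pM // ?sqr_ge0 ?lerXn2r ?nnegrE //; lra.
have gain : e ^+ 2 / t0 ^+ 2 < h * (e / (2 * S)).
  rewrite ltr_pdivrMr ?exprn_gt0 // [ltRHS](_ : _ = e * (2 * (h * t0 ^+ 2 / (4 * S)))); last first.
    by field; rewrite lt0r_neq0.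
  by rewrite expr2 ltr_pM2l //; lra.
have : h * (x ^+ 4 / (e + x ^+ 2) ^+ 2 + \sum_(j <- s') j ^+ 4 / (e + j ^+ 2) ^+ 2) <=
  h * (1 - e / (2 * S) + \sum_(j <- s') j ^+ 4 / (0 + j ^+ 2) ^+ 2).
  by rewrite (ler_pM2l h0); exact: lerD head rest.
lra.
Qed.

(** The variance terms cancel. As the weights sum to 1, the bias term at [S] is spread over all
    indices and increments are compared index by index. *)
Lemma filtered_risk_diff_mono (S x y : R) :
  (forall i, l i <= S) -> 0 <= x -> x <= y -> y <= t0 ->
  q x - filtered_risk R 'I_1 (fun=> 1) (fun=> S) s h x <=
  q y - filtered_risk R 'I_1 (fun=> 1) (fun=> S) s h y.
Proof.
move=> lS x0 xy yt; rewrite /filtered_risk !big_ord1 !mul1r.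
suff : y ^+ 2 / (y + S) ^+ 2 - x ^+ 2 / (x + S) ^+ 2 <=
  \sum_i w i * (y ^+ 2 / (y + l i) ^+ 2) - \sum_i w i * (x ^+ 2 / (x + l i) ^+ 2) by lra.
rewrite -[leLHS]mul1r -w1 mulr_suml -sumrB; apply: ler_sum => i _.
rewrite -mulrBr ler_wpM2l // filter_increment_antitone //.
- exact: le_trans yt (lt0 i).
- exact: lt_le_trans t0_gt0 (lt0 i).
Qed.
End filtered_risk.

(** The strict bounds [astar < t0] and [astar < S / 2] leave room to the right of [astar] for both
    the monotonicity of the difference and the minimality of [astar]. *)
Lemma filtered_risk_local_min (R : realType) (I : finType) (w l : I -> R)
    (s : seq R) (h t0 S astar : R) :
  (forall i, 0 <= w i) -> \sum_i w i = 1 -> 0 < t0 ->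
  (forall i, t0 <= l i) -> (forall i, l i <= S) -> s`_0 ^+ 2 = S ->
  s != [::] -> {in s, forall x, 0 < x} -> 0 < h ->
  is_minimizer_on `[0, S / 2] (T_fun s h) astar ->
  astar < t0 -> astar < S / 2 ->
  exists b, [/\ 0 < b, b <= astar & \forall y \near b, 0 < y ->
    filtered_risk R I w l s h b <= filtered_risk R I w l s h y].
Proof.
move=> w0 w1 t0_gt0 lt0 lS sS snil s_gt0 h0 [].
rewrite /= in_itv /= => /andP[a_ge0 _] Tmin at0 aS.
set q := filtered_risk _ _ _ _ _ _.
have TE y : T_fun s h y = filtered_risk R 'I_1 (fun=> 1) (fun=> S) s h y.
  by rewrite T_fun_filtered sS.
have S0 : 0 < S by lra.
(* Were [astar] zero, T_h would take a smaller value in [[0, S / 2]]. Positivity of [astar] is then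
   what excludes 0 as a minimizer of [q] over [[0, astar]]. *)
have a_gt0 : 0 < astar.
  rewrite lt_neqAle a_ge0 andbT; apply/eqP => a0.
  have [||e [e0 eS]] := filtered_risk_decr R 'I_1 (fun=> 1) (fun=> S) s h S
    (fun=> ler01) _ S0 (fun=> lexx _) s_gt0 h0 (S / 2) snil.
  - by rewrite big_ord1.
  - by rewrite divr_gt0.
  - by rewrite -!TE a0 ltNge Tmin //= in_itv /= eS ltW.
have cq : {within `[0, astar], continuous q}.
  apply: continuous_in_subspaceT => a; rewrite inE /= in_itv /= => /andP[a0 _].
  exact: (filtered_risk_continuous _ _ _ _ _ _ t0).
have [b] := EVT_min a_ge0 cq.
rewrite in_itv /= => /andP[b_ge0 b_le] bmin.
have b_gt0 : 0 < b.
  rewrite lt_neqAle b_ge0 andbT; apply/eqP => b0.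
  have [e [e0 ea]] := filtered_risk_decr R I w l s h t0
    w0 w1 t0_gt0 lt0 s_gt0 h0 astar snil a_gt0.
  by rewrite -/q ltNge b0 bmin // in_itv /= ea ltW.
exists b; split=> //.
move: b_le; rewrite le_eqVlt => /predU1P[ba|ba].
- have bt : b < Num.min t0 (S / 2) by rewrite ba lt_min at0.
  near=> y => y0.
  have [ya|ay] := leP y astar; first by apply: bmin; rewrite in_itv /= ya ltW.
  have : y < Num.min t0 (S / 2) by near: y; exact: lt_nbhsl.
  rewrite lt_min => /andP[yt yS].
  have := filtered_risk_diff_mono R I w l s h t0 w0 w1 t0_gt0 lt0 S astar y
    lS a_ge0 (ltW ay) (ltW yt).
  have := Tmin y; rewrite /= in_itv /= !TE -/q ba (ltW y0) (ltW yS).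
  by move=> /(_ isT); lra.
- near=> y => y0; apply: bmin; rewrite in_itv /= ltW //= ltW //.
  by near: y; exact: lt_nbhsl.
Unshelve. all: by end_near. Qed.

(** * From singular values to the filtered form of the risk *)

Lemma singular_values_diagonalization (R : realType) (n m : nat)
    (A : 'M[R]_(n, m)) (s : seq R) : positive_singular_values A s ->
  exists (P : 'M[R]_m) (l : 'rV[R]_m),
    [/\ P *m P^T = 1%:M, A^T *m A = P^T *m diag_mx l *m P,
        forall i, l 0 i = 0 \/ exists2 x, x \in s & l 0 i = x ^+ 2 &
        forall F : R -> R, F 0 = 0 ->
          \sum_i F (l 0 i) = \sum_(x <- s) F (x ^+ 2)].
Proof.
move=> [_ _ charA].
(* Padding with zeros gives all [m] eigenvalues of [A^T *m A]; the condition [F 0 = 0] makes the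
   padding invisible in sums. *)
pose ls := [seq x ^+ 2 | x <- s] ++ nseq (m - size s) 0.
have charE : char_poly (A^T *m A) = \prod_(x <- ls) ('X - x%:P).
  rewrite charA /ls big_cat big_map /= mulrC; congr (_ * _).
  by rewrite big_nseq polyC0 subr0 -Monoid.iteropE /= exprnP.
have sz : size ls = m.
  by have := size_char_poly (A^T *m A); rewrite charE size_prod_XsubC => -[].
have [|P [PP PE]] := symmetric_diagonalization _ _ _ _ _ charE.
  by rewrite trmx_mul trmxK.
exists P, (\row_i ls`_i); split=> // [i|F F0].
  rewrite mxE; have : ls`_i \in ls by rewrite mem_nth // sz.
  rewrite mem_cat => /orP[/mapP[x xs ->]|]; first by right; exists x.
  by rewrite mem_nseq => /andP[_ /eqP ->]; left.
under eq_bigr do rewrite mxE.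
rewrite -(big_mkord xpredT (fun i => F ls`_i)) -[X in index_iota _ X]sz.
rewrite -(big_nth 0 xpredT F) /ls big_cat big_map /= [X in _ + X]big1_seq ?addr0 //.
by move=> y; rewrite mem_nseq => /andP[_ /andP[_ /eqP ->]].
Qed.

(** The weights and nodes are fixed before [sigma] and the noise, so a threshold built from them
    cannot depend on the noise level. *)
Lemma predictive_risk_filtered (R : realType) (n m : nat) (A : 'M[R]_(n, m))
    (s : seq R) (f : 'cV[R]_m) :
  positive_singular_values A s -> A *m f != 0 ->
  exists w l : 'I_m -> R,
    [/\ forall i, 0 <= w i, \sum_i w i = 1,
        forall i, exists2 x, x \in s & l i = x ^+ 2 &
    forall (sigma : R) (d : measure_display) (T : measurableType d)
      (P : probability T R) (eta : T -> 'cV[R]_n),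
      (forall i, measurable_fun [set: T] (fun w => eta w i 0)) ->
      has_mean P eta 0 -> has_covariance P eta (sigma ^+ 2)%:M ->
      let rho := euclid_norm (A *m f) in
      forall a, 0 < a ->
      predictive_risk P A (A *m f) eta a =
        (rho ^+ 2 * filtered_risk R 'I_m w l s (sigma ^+ 2 / rho ^+ 2) a)%:E].
Proof.
move=> hs g0; have [P [l [PP AA ls sumF]]] := singular_values_diagonalization _ _ _ _ _ hs.
pose rho2 := euclid_norm (A *m f) ^+ 2.
have rho2_gt0 : 0 < rho2 by exact: sqr_euclid_norm_gt0.
have rho2E := sqr_norm_image _ _ _ _ _ _ AA f; rewrite -/rho2 in rho2E.
have l0 i : 0 <= l 0 i by have [->//|[x _ ->]] := ls i; exact: sqr_ge0.
(* Without positive singular values all eigenvalues vanish, and so does [A *m f]. *)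
have [x0 x0s] : exists x, x \in s.
  case: s hs ls sumF => [|x s] _ ls _; last by exists x; exact: mem_head.
  exfalso; move: rho2_gt0; rewrite rho2E big1 ?ltxx // => i _.
  by have [->|[]//] := ls i; rewrite mul0r.
(* Normalized squared coordinates of [A *m f] along the left singular vectors. *)
exists (fun i => l 0 i * (P *m f) i 0 ^+ 2 / rho2).
(* Null eigenvalues carry weight 0; replacing them by an arbitrary squared
   singular value keeps every term continuous at a = 0. *)
exists (fun i => if l 0 i == 0 then x0 ^+ 2 else l 0 i); split.
- by move=> i; apply: divr_ge0; [apply: mulr_ge0 => //; exact: sqr_ge0|exact: ltW].
- by rewrite -mulr_suml -rho2E divff // gt_eqF.
- move=> i; case: eqP => [_|li0]; first by exists x0.
  by have [|[x xs ->]] := ls i => //; exists x.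
move=> sigma d T Pr eta meta mean cov rho a a0.
have la i : l 0 i + a != 0 by rewrite gt_eqF // ltr_wpDl.
rewrite /predictive_risk.
under [X in ('E_Pr[X])%E]eq_fun do rewrite mulmxDr [_ + influence _ _ *m _]addrC -addrA.
rewrite (expectation_sqnorm_affine _ _ _ _ _ _ _ meta mean cov).
rewrite (influence_frobenius _ _ _ _ _ _ PP AA _ la).
rewrite (influence_bias _ _ _ _ _ _ PP AA _ la).
congr (_%:E); rewrite /filtered_risk -/rho2 mulrDr addrC; congr (_ + _).
  rewrite mulr_sumr; apply: eq_bigr => i _.
  have [li0|li0] := eqVneq (l 0 i) 0; first by rewrite li0 !mul0r mulr0.
  rewrite [RHS]mulrA; congr (_ * _).
  by rewrite [RHS]mulrC divfK // gt_eqF.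
rewrite mulrA [rho2 * _]mulrCA divff ?mulr1 ?gt_eqF //; congr (_ * _).
(* Null eigenvalues drop out of the variance, because the filter vanishes at 0. *)
rewrite (sumF (fun y => (y / (y + a)) ^+ 2)); last by rewrite mul0r expr0n.
by apply: eq_bigr => x _; rewrite expr_div_n -exprM addrC.
Qed.

(** * Choice of a threshold independent of the noise level *)

Theorem proposition2 (R : realType) (n m r : nat) (A : 'M[R]_(n, m))
    (s : r.-tuple R) (f : 'cV[R]_m) (g : 'cV[R]_n)
    (hA : A != 0) (hr : \rank A = r) (hs : positive_singular_values A s)
    (hg : g = A *m f) (hg0 : g != 0) :
  exists alpha0 : R, 0 < alpha0 /\
    forall sigma : R, 0 < sigma ->
    forall (d : measure_display) (T : measurableType d) (P : probability T R)
           (eta : T -> 'cV[R]_n),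
      gaussian_vector P eta ->
      has_mean P eta 0 ->
      has_covariance P eta (sigma ^+ 2)%:M ->
    let rho := euclid_norm g in
    let h := sigma ^+ 2 / rho ^+ 2 in
    forall alphastar : R,
      is_minimizer_on `[0, s`_0 ^+ 2 / 2] (T_fun s h) alphastar ->
      alphastar <= alpha0 ->
      exists alphahat : R,
        is_local_minimizer_on `]0, +oo[ (predictive_risk P A g eta) alphahat /\
        alphahat <= alphastar.
Proof.
subst g; have [w [l [w0 w1 lE riskE]]] := predictive_risk_filtered _ _ _ _ _ _ hs hg0.
have [s_sorted s_gt0 _] := hs.
have snil : s != [::] :> seq R by rewrite -size_eq0 size_tuple -hr mxrank_eq0.
have s0s : s`_0 \in (s : seq R) by rewrite mem_nth // lt0n size_eq0.
pose S := s`_0 ^+ 2.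
have S0 : 0 < S by rewrite exprn_gt0 // s_gt0.
have sS x : x \in (s : seq R) -> x <= s`_0.
  case: (tval s) s_sorted snil => //= y t /(order_path_min ge_trans) /allP yt _.
  by rewrite in_cons => /predU1P[->//|/yt].
have [t0 [t0_gt0 t0s]] : exists t0, 0 < t0 /\ {in (s : seq R), forall x, t0 <= x ^+ 2}.
  (* The running minimum starts from 1, so [t0] is a positive lower bound of the squared singular
     values, not necessarily the smallest of them. *)
  elim: (tval s) s_gt0 => [|x t IH] xt_gt0; first by exists 1.
  have [|t0 [t0_gt0 t0t]] := IH; first by move=> y yt; apply: xt_gt0; rewrite in_cons yt orbT.
  exists (Num.min (x ^+ 2) t0); split.
    by rewrite lt_min t0_gt0 exprn_gt0 // xt_gt0 ?mem_head.
  by move=> y; rewrite in_cons ge_min => /predU1P[->|/t0t ->]; rewrite ?lexx ?orbT.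
(* Halving [t0] and [S / 2] turns [astar <= alpha0] into the strict inequalities that the local
   argument requires. *)
exists (Num.min (t0 / 2) (S / 4)); split; first by rewrite lt_min !divr_gt0.
move=> sigma sigma0 d T P eta [meta _] mean cov rho h astar Tmin.
rewrite le_min => /andP[at0 aS].
have rho0 : 0 < rho ^+ 2 by exact: sqr_euclid_norm_gt0.
have h0 : 0 < h by apply: divr_gt0 => //; exact: exprn_gt0.
have [||||b [b0 ba bmin]] := filtered_risk_local_min R 'I_m w l s h t0 S astar
  w0 w1 t0_gt0 _ _ erefl snil s_gt0 h0 Tmin.
- by move=> i; have [x /t0s xt ->] := lE i.
- move=> i; have [x xs ->] := lE i.
  by apply: lerXn2r; [apply/ltW/s_gt0|apply/ltW/s_gt0|exact: sS].
- by lra.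
- by lra.
exists b; split=> //; split; first by rewrite /= in_itv /= b0.
near=> y; rewrite /= in_itv /= andbT => y0.
(* The filtered form of the risk is available at positive points only, which the restriction to []0,
   +oo[] provides; the factor rho^2 > 0 preserves the inequality. *)
rewrite !(riskE _ _ _ _ _ meta mean cov) // lee_fin ler_pM2l //.
by move: y0; near: y; exact: bmin.
Unshelve. all: by end_near. Qed.
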